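(* Any two caterpillar graphs $C_1$ and $C_2$ on the same vertex set of size $n$ have a $2$-layer geometric embedding on a grid of size $O(n^2) \times O(n^3)$. That is, there is an absolute constant $K$ such that for every $n \ge 1$, any two caterpillar graphs on the same $n$-element vertex set have a $2$-layer geometric embedding on an $a \times b$ grid with $a \le K n^2$ and $b \le K n^3$.
   Context: Graphs are finite and simple. A caterpillar graph is a tree whose vertex set is the disjoint union of $V_p = \{p_1, \dots, p_{n'}\}$ (parent vertices) and $V_l$ (leg vertices, possibly empty), and whose edge set is the union of $E_p = \{p_1p_2, p_2p_3, \dots, p_{n'-1}p_{n'}\}$ (the spine path) and $E_l = \{\, p(l)\,l : l \in V_l \,\}$, where $p(l) \in V_p$ is the unique parent of the leg $l$. Let $G_i = (V, E_i)$, $1 \le i \le k$, be $k$ graphs on the same vertex set $V$ with possibly different edge sets. A $k$-layer geometric embedding (also called a simultaneous geometric embedding with mapping) of $G_1,\dots,G_k$ is an injective map $\phi : V \to \mathbb{R}^2$ such that, when every edge $uv$ is drawn as the straight segment $\overline{\phi(u)\phi(v)}$, for each $i$ the resulting drawing of $G_i$ is plane: two distinct edges of the same $E_i$ meet only at a common endpoint, and no edge of $E_i$ passes through the image of a vertex that is not one of its endpoints. Edges that do not both lie in a common $E_i$ may cross. The embedding is on an $a \times b$ grid if $\phi(V) \subseteq \{1,\dots,a\} \times \{1,\dots,b\}$ (up to an integer translation). *)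

(* Defs.v *)
From mathcomp Require Import all_boot all_order all_algebra.
From mathcomp Require Import classical_sets reals.

Set Implicit Arguments.
Unset Strict Implicit.
Unset Printing Implicit Defensive.

Import Order.TTheory GRing.Theory Num.Theory.
Local Open Scope ring_scope.

Record simple_graph (V : finType) := SimpleGraph {
  adj :> rel V;
  adj_sym : symmetric adj;
  adj_irrefl : irreflexive adj
}.

Definition is_tree (V : finType) (G : simple_graph V) : Prop :=
  (forall u v : V, connect G u v) /\
  (forall c : seq V, (3 <= size c)%N -> ~ ucycle G c).

(* [p] lists the parents p_1, ..., p_n' along the spine; the legs are the
   vertices outside [p].  [parent] is total, but its values on the spine play
   no role. *)
Definition caterpillar_edge (V : finType) (p : seq V) (parent : V -> V) :
    rel V :=
  fun u v => ((u, v) \in zip p (behead p)) ||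
             ((v \notin p) && (u == parent v)).

Definition is_caterpillar (V : finType) (G : simple_graph V) : Prop :=
  is_tree G /\
  exists (p : seq V) (parent : V -> V),
    [/\ uniq p,
        forall l : V, l \notin p -> parent l \in p
      & forall u v : V,
          G u v = caterpillar_edge p parent u v ||
                  caterpillar_edge p parent v u].

Section Embedding.
Variables (R : realType) (V : finType).
Implicit Types (G : simple_graph V) (phi : V -> 'rV[R]_2).

Definition segment (x y : 'rV[R]_2) : set 'rV[R]_2 :=
  [set z | exists t : R, 0 <= t <= 1 /\ z = (1 - t) *: x + t *: y]%classic.

Definition plane_drawing G phi : Prop :=
  (forall u v x y : V, G u v -> G x y -> [set u; v] != [set x; y] ->
     forall z : 'rV[R]_2,
       segment (phi u) (phi v) z -> segment (phi x) (phi y) z ->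
       exists2 w : V, w \in [set u; v] :&: [set x; y] & z = phi w) /\
  (forall u v w : V, G u v -> w \notin [set u; v] ->
     ~ segment (phi u) (phi v) (phi w)).

Definition layer_embedding (k : nat) (Gs : 'I_k -> simple_graph V) phi : Prop :=
  injective phi /\ forall i : 'I_k, plane_drawing (Gs i) phi.

(* [(c, d)] is the integer translation of the grid {1..a} x {1..b}. *)
Definition on_grid (a b : nat) phi : Prop :=
  exists c d : int, forall v : V, exists i j : nat,
    [/\ (1 <= i <= a)%N, (1 <= j <= b)%N,
        phi v 0 0 = i%:R + c%:~R & phi v 0 1 = j%:R + d%:~R].

End Embedding.

(* Main.v *)
(* Order the vertices of a caterpillar by listing each parent followed by its
   legs, along the spine.  If one coordinate of a drawing respects this order,
   then the edges leaving different parents towards later vertices lie in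
   different strips, so crossings can only come from collinear triples.  It
   therefore suffices to let the first coordinate be the rank for C1, to let
   the second coordinate lie in a block indexed by the rank for C2, and to have
   no three points collinear.  Blocks of size n^2 + 1 allow this greedily: each
   of the at most n^2 lines through two points placed before excludes at most
   one position for the next one. *)
Require Import Defs.
From mathcomp Require Import all_boot all_order all_algebra.
From mathcomp Require Import classical_sets reals.
From mathcomp Require Import zify lra.

Set Implicit Arguments.
Unset Strict Implicit.
Unset Printing Implicit Defensive.

Import Order.TTheory GRing.Theory Num.Theory.
Local Open Scope ring_scope.

(** * Linear orders of the vertices of a caterpillar *)

Definition strip_order (V : finType) (G : rel V) (f : V -> nat) : Prop :=
  forall u v x y : V, G u v -> G x y -> (f u < f v)%N -> (f x < f y)%N ->
    [\/ u = x, (f v <= f x)%N | (f y <= f u)%N].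

Lemma strip_order_mono (V : finType) (G : rel V) (f h : V -> nat) :
  (forall u v, (h u < h v)%N = (f u < f v)%N) ->
  strip_order G f -> strip_order G h.
Proof.
move=> fh sf u v x y Guv Gxy; rewrite !fh => fuv fxy.
have fh' a b : (h a <= h b)%N = (f a <= f b)%N by rewrite (leqNgt (h a)) (leqNgt (f a)) fh.
by rewrite !fh'; exact: sf.
Qed.

Lemma index_zip_behead (T : eqType) (p : seq T) (u v : T) :
  uniq p -> (u, v) \in zip p (behead p) ->
  [/\ u \in p, v \in p & index v p = (index u p).+1].
Proof.
move=> up /(nthP (u, v)) [i ilt]; rewrite nth_zip_cond ilt /= nth_behead.
have szi : (i.+1 < size p)%N.
  by move: ilt; rewrite size_zip size_behead leq_min => /andP[_]; lia.
move=> [eu ev]; have ilt' := ltnW szi.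
split; [by rewrite -eu mem_nth | by rewrite -ev mem_nth |].
by rewrite -{1}ev -{1}eu !index_uniq.
Qed.

Section CaterpillarOrder.
Variables (V : finType) (p : seq V) (parent : V -> V).
Hypotheses (up : uniq p) (parentp : forall l : V, l \notin p -> parent l \in p).

(** A two-digit numeral in base [#|V|.+1]: the high digit is a spine index, the low digit is 0 for
    the parent itself and positive for its legs, which therefore fall strictly between it and the
    next parent. *)
Definition caterpillar_key (v : V) : nat :=
  if v \in p then (index v p * #|V|.+1)%N
  else (index (parent v) p * #|V|.+1 + (enum_rank v).+1)%N.

Lemma caterpillar_key_inj : injective caterpillar_key.
Proof.
move=> u v; rewrite /caterpillar_key.
have digit a b x y : (x <= #|V|)%N -> (y <= #|V|)%N ->
    (a * #|V|.+1 + x = b * #|V|.+1 + y -> x = y)%N.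
  by move=> hx hy /(congr1 (modn^~ #|V|.+1)); rewrite !modnMDl !modn_small.
have ru := ltn_ord (enum_rank u); have rv := ltn_ord (enum_rank v).
case: ifP => pu; case: ifP => pv e.
- move/eqP: e; rewrite eqn_pmul2r // => /eqP e.
  by rewrite -(nth_index u pu) e nth_index.
- by move: e; rewrite -[LHS]addn0 => /digit -/(_ isT rv).
- by move: e; rewrite -[RHS]addn0 => /digit -/(_ ru isT).
- by apply/enum_rank_inj/val_inj; case: (digit _ _ _ _ ru rv e).
Qed.

(** A spine edge ends exactly where the next parent's strip begins, and the low digit of a leg is at
    most [#|V|]. *)
Lemma caterpillar_edge_key (u v : V) : caterpillar_edge p parent u v ->
  [/\ u \in p, (caterpillar_key u < caterpillar_key v)%N
    & (caterpillar_key v <= (index u p).+1 * #|V|.+1)%N].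
Proof.
rewrite /caterpillar_key => /orP[/(index_zip_behead up) [pu pv ->]|].
  by rewrite pu pv ltn_pmul2r.
move=> /andP[pv /eqP ->]; have pp := parentp pv.
rewrite (negPf pv) pp; split=> //; first by rewrite addnS ltnS leq_addr.
by rewrite mulSn addnC leq_add2r ltnW // ltnS ltn_ord.
Qed.

(** The lower end of every edge is a parent, so comparing the spine indices of the two lower ends
    decides which alternative holds. *)
Lemma caterpillar_key_strip (G : rel V) :
  (forall u v, G u v = caterpillar_edge p parent u v ||
                       caterpillar_edge p parent v u) ->
  strip_order G caterpillar_key.
Proof.
move=> GE.
have oriented a b : G a b -> (caterpillar_key a < caterpillar_key b)%N ->
    a \in p /\ (caterpillar_key b <= (index a p).+1 * #|V|.+1)%N.
  rewrite GE => /orP[] /caterpillar_edge_key[pa lt_ab le_b] // lt_ba.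
  by move: (ltn_trans lt_ab lt_ba); rewrite ltnn.
move=> u v x y Guv Gxy /(oriented _ _ Guv)[pu lev] /(oriented _ _ Gxy)[px ley].
rewrite {2}/caterpillar_key px {3}/caterpillar_key pu.
case: (ltngtP (index u p) (index x p)) => cmp.
- by apply: Or32; apply: leq_trans lev _; rewrite leq_pmul2r.
- by apply: Or33; apply: leq_trans ley _; rewrite leq_pmul2r.
- by apply: Or31; rewrite -(nth_index u pu) cmp nth_index.
Qed.

End CaterpillarOrder.

(** Compresses the keys, which may be quadratic in [#|V|], to values below [#|V|]; only their order
    matters for the strips. *)
Lemma injective_rank (V : finType) (g : V -> nat) :
  exists r : V -> nat, (forall v, (r v < #|V|)%N) /\
    (forall u v, (r u < r v)%N = (g u < g v)%N).
Proof.
exists (fun v => #|[set w | (g w < g v)%N]|); split=> [v|u v].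
  rewrite -cardsT; apply: proper_card; apply/properP; split; first exact: finset.subsetT.
  by exists v; rewrite ?inE // ltnn.
case: (ltnP (g u) (g v)) => guv.
  apply: proper_card; apply/properP; split.
    by apply/fintype.subsetP=> w; rewrite !inE => /ltn_trans; apply.
  by exists u; rewrite ?inE // ltnn.
apply/negbTE; rewrite -leqNgt; apply: subset_leq_card.
by apply/fintype.subsetP=> w; rewrite !inE => /leq_trans; apply.
Qed.

Lemma caterpillar_rank (V : finType) (G : simple_graph V) :
  is_caterpillar G ->
  exists r : V -> nat,
    [/\ forall v, (r v < #|V|)%N, injective r & strip_order G r].
Proof.
move=> [_ [p [parent [up pp GE]]]].
have [r [rlt rE]] := injective_rank (caterpillar_key p parent).
exists r; split=> //.
  move=> u v ruv; apply: (@caterpillar_key_inj _ p parent).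
  by apply/eqP; case: ltngtP => //; rewrite -rE ruv ltnn.
exact: strip_order_mono rE (caterpillar_key_strip up pp GE).
Qed.

(** * Orientation of triples and planarity of strip-ordered drawings *)

Section GeneralPosition.
Variable R : realType.
Implicit Types a b c z : 'rV[R]_2.

(** Twice the signed area of the triangle [a b c]; it vanishes exactly on collinear triples. *)
Definition orient a b c : R :=
  (b 0 0 - a 0 0) * (c 0 1 - a 0 1) - (c 0 0 - a 0 0) * (b 0 1 - a 0 1).

(** Relative to a list [s], so that vertices can be placed one at a time. *)
Definition general_position (V : finType) (s : seq V) (phi : V -> 'rV[R]_2) :=
  forall u v w, u \in s -> v \in s -> w \in s ->
    u != v -> u != w -> v != w -> orient (phi u) (phi v) (phi w) != 0.

Lemma segment_sym a b z : segment a b z -> segment b a z.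
Proof.
move=> [t [/andP[t0 t1] ->]]; exists (1 - t).
by split; [lra | rewrite subKr addrC].
Qed.

Lemma segment_coord (j : 'I_2) a b z : a 0 j < b 0 j -> segment a b z ->
  [/\ a 0 j <= z 0 j, z 0 j <= b 0 j & (b 0 j <= z 0 j -> z = b)].
Proof.
move=> ab [t [/andP[t0 t1] zE]].
have zj : z 0 j = a 0 j + t * (b 0 j - a 0 j) by rewrite zE !mxE; lra.
split; [by rewrite zj; nra | by rewrite zj; nra|].
rewrite zj => le; have te : t = 1 by nra.
by rewrite zE te subrr scale0r add0r scale1r.
Qed.

Lemma segment_orient0 a b z : segment a b z -> orient a b z = 0.
Proof. by move=> [t [_ ->]]; rewrite /orient !mxE; lra. Qed.

Lemma segments_common_end a b c z : segment a b z -> segment a c z ->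
  orient a b c != 0 -> z = a.
Proof.
move=> [t [_ zt]] [s [_ zs]] abc.
have e j : t * (b 0 j - a 0 j) = s * (c 0 j - a 0 j).
  have : ((1 - t) *: a + t *: b) 0 j = ((1 - s) *: a + s *: c) 0 j.
    by rewrite -zt zs.
  by rewrite !mxE; lra.
(* By [e], [t (b - a) = s (c - a)]; the cross product with [c - a] kills the right-hand side. *)
have /eqP : t * orient a b c = 0.
  by rewrite /orient mulrBr mulrA e [t * (_ * (b _ _ - _))]mulrCA e; lra.
rewrite mulf_eq0 (negPf abc) orbF => /eqP t0.
by rewrite zt t0 subr0 scale0r addr0 scale1r.
Qed.

Lemma strip_order_plane (V : finType) (G : simple_graph V)
    (phi : V -> 'rV[R]_2) (f : V -> nat) (j : 'I_2) :
  injective f -> (forall v, phi v 0 j = (f v)%:R) -> strip_order G f ->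
  general_position (enum V) phi -> plane_drawing G phi.
Proof.
move=> finj phij sf gp.
have gpT u v w : u != v -> u != w -> v != w -> orient (phi u) (phi v) (phi w) != 0.
  by apply: gp; rewrite mem_enum.
have neq u v : G u v -> u != v by apply: contraTneq => ->; rewrite adj_irrefl.
(* Strips may share a boundary, as for consecutive spine edges. A common point then lies on that
   boundary, hence is the upper end of one edge and the lower end of the other. *)
have touch u v x y z : (f u < f v)%N -> (f x < f y)%N -> (f v <= f x)%N ->
    segment (phi u) (phi v) z -> segment (phi x) (phi y) z ->
    v = x /\ z = phi v.
  move=> fuv fxy fvx.
  have lt_uv : phi u 0 j < phi v 0 j by rewrite !phij ltr_nat.
  have lt_xy : phi x 0 j < phi y 0 j by rewrite !phij ltr_nat.
  move=> /(segment_coord lt_uv)[_ le_zv zv] /(segment_coord lt_xy)[le_xz _ _].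
  split; last by apply: zv; apply: le_trans le_xz; rewrite !phij ler_nat.
  apply/finj/eqP; rewrite eqn_leq fvx -(ler_nat R) -!phij.
  exact: le_trans le_xz le_zv.
have oriented u v x y z : G u v -> G x y -> [set u; v] != [set x; y] ->
    (f u < f v)%N -> (f x < f y)%N ->
    segment (phi u) (phi v) z -> segment (phi x) (phi y) z ->
    exists2 w, w \in [set u; v] :&: [set x; y] & z = phi w.
  move=> Guv Gxy ne fuv fxy zuv zxy.
  case: (sf u v x y Guv Gxy fuv fxy) => [ux|fvx|fyu].
  - subst x; exists u; first by rewrite !inE eqxx.
    apply: (segments_common_end zuv zxy); apply: gpT.
    + exact: neq.
    + exact: neq.
    + by apply: contraNneq ne => ->.
  - have [vx zE] := touch u v x y z fuv fxy fvx zuv zxy.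
    by exists v; rewrite // !inE vx eqxx orbT.
  - have [yu zE] := touch x y u v z fxy fuv fyu zxy zuv.
    by exists y; rewrite // !inE yu eqxx orbT.
split=> [u v x y Guv Gxy|u v w Guv].
  have fne s t : G s t -> (f s < f t)%N || (f t < f s)%N.
    by move=> /neq; rewrite -neq_ltn; apply: contraNneq => /finj ->.
  have Gvu : G v u by rewrite adj_sym.
  have Gyx : G y x by rewrite adj_sym.
  move=> ne z zuv zxy.
  have zvu := segment_sym zuv; have zyx := segment_sym zxy.
  have [/orP[] fuv /orP[] fxy] := (fne u v Guv, fne x y Gxy).
  - exact: oriented.
  - by rewrite [[set x; y]]finset.setUC; apply: oriented; rewrite // [[set y; x]]finset.setUC.
  - by rewrite [[set u; v]]finset.setUC; apply: oriented; rewrite // [[set v; u]]finset.setUC.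
  - rewrite [[set u; v]]finset.setUC [[set x; y]]finset.setUC.
    by apply: oriented; rewrite // [[set v; u]]finset.setUC [[set y; x]]finset.setUC.
rewrite !inE negb_or => /andP[wu wv] /segment_orient0/eqP.
by apply/negP; apply: gpT; [exact: neq | rewrite eq_sym | rewrite eq_sym].
Qed.

End GeneralPosition.

(** * Greedy choice of offsets avoiding collinear triples *)

Lemma avoid_unique_bad (D P : finType) (bad : D -> P -> bool) :
  (#|P| < #|D|)%N -> (forall x d d', bad d x -> bad d' x -> d = d') ->
  exists d, forall x, ~~ bad d x.
Proof.
move=> PD badU; case: (pickP (fun d => [forall x, ~~ bad d x])) => [d /forallP|].
  by exists d.
move=> none; have ex d : exists x, bad d x.
  by move/negbT: (none d); rewrite negb_forall => /existsP[x /negPn]; exists x.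
(* If every [d] were bad, choosing a witness for each would inject [D] into the smaller [P]. *)
suff /leq_card : injective (fun d => xchoose (ex d)) by rewrite leqNgt PD.
move=> d d' e; apply: (badU _ _ _ (xchooseP (ex d))).
by rewrite e; exact: xchooseP.
Qed.

Section Blocks.
Variables (R : realType) (V : finType) (f g : V -> nat) (M : nat).

(** With [f] and [g] fixed, the offset [e] inside blocks of height [M] is the only freedom left. *)
Definition block_point (e : V -> nat) (v : V) : 'rV[R]_2 :=
  \row_j (if j == 0 then (f v)%:R else (g v * M + e v)%N%:R).

Lemma block_general_position : (#|V| ^ 2 < M)%N -> injective f ->
  exists e : V -> nat,
    (forall v, (e v < M)%N) /\ general_position (enum V) (block_point e).
Proof.
move=> ltM finj.
elim: (enum V) (enum_uniq V) => [_|v s IHs /=/andP[vs us]].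
  by exists (fun=> 0%N); split=> // v; apply: leq_ltn_trans ltM.
have {IHs} [e [elt egp]] := IHs us.
pose upd (d : nat) u := if u == v then d else e u.
pose bad (d : 'I_M) (x : V * V) :=
  [&& x.1 \in s, x.2 \in s, x.1 != x.2 &
   orient (block_point (upd d) v) (block_point (upd d) x.1)
     (block_point (upd d) x.2) == 0].
have out u : u \in s -> (u == v) = false.
  by move=> us'; apply: contraNF vs => /eqP <-.
have [||d dgood] := @avoid_unique_bad _ _ bad.
- by rewrite card_prod card_ord.
- move=> [x y] d d' /and4P[/= xs ys xy /eqP h] /and4P[_ _ _ /eqP /= h'].
  (* The orientation is affine in the offset of [v] with slope [f y - f x], which is non-zero; so
     each pair excludes at most one offset. *)
  have fxy : (f x)%:R - (f y)%:R != 0 :> R.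
    by rewrite subr_eq0 eqr_nat; apply: contra_neq xy => /finj.
  move: h h'; rewrite /orient !mxE /= /upd eqxx !out // !natrD => h h'.
  apply/val_inj/eqP => /=; rewrite -(eqr_nat R) -subr_eq0.
  by rewrite -(mulrI_eq0 _ (mulfI fxy)); apply/eqP; lra.
exists (upd d); split=> [u|]; first by rewrite /upd; case: ifP.
have updE u : u \in s -> block_point (upd d) u = block_point e u.
  by move=> us'; apply/rowP=> j; rewrite !mxE /upd out.
have good x y : x \in s -> y \in s -> x != y ->
    orient (block_point (upd d) v) (block_point (upd d) x)
      (block_point (upd d) y) != 0.
  by move=> xs ys xy; move: (dgood (x, y)); rewrite /bad /= xs ys xy.
(* The new vertex may occur at any place of the triple; a cyclic rotation brings it to the front. *)
have cycle (a b c : 'rV[R]_2) : orient a b c = orient b c a.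
  by rewrite /orient; lra.
move=> x y z; rewrite !inE.
move=> /predU1P[->|xs] /predU1P[->|ys] /predU1P[->|zs] xy xz yz;
  rewrite ?eqxx // in xy xz yz *.
- exact: good.
- by rewrite cycle; apply: good; rewrite // eq_sym.
- by rewrite -cycle; apply: good.
- by rewrite !updE //; apply: egp.
Qed.

End Blocks.

(** * Assembly of the two layers on the grid *)

Theorem theorem3 (R : realType) :
  exists K : nat,
    forall (n : nat) (V : finType) (C1 C2 : simple_graph V),
      (1 <= n)%N -> #|V| = n ->
      is_caterpillar C1 -> is_caterpillar C2 ->
      exists (a b : nat) (phi : V -> 'rV[R]_2),
        [/\ (a <= K * n ^ 2)%N, (b <= K * n ^ 3)%N,
            layer_embedding (tnth [tuple C1; C2]) phi
          & on_grid a b phi].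
Proof.
(* The height is [n * (n ^ 2 + 1)], at most [2 * n ^ 3] because [n] is positive. *)
exists 2 => n V C1 C2 n0 Vn /caterpillar_rank[f [flt finj fC1]].
move=> /caterpillar_rank[g [glt ginj gC2]].
pose M := (n ^ 2).+1.
have [||e [elt gp]] := @block_general_position R V f g M; rewrite ?Vn //.
pose h v := (g v * M + e v)%N.
(* Offsets stay below [M], so the second coordinate orders the vertices as [g] does. *)
have hg u v : (h u < h v)%N = (g u < g v)%N.
  rewrite /h; have := elt u; have := elt v; set m := M => ev eu.
  by case: (ltngtP (g u) (g v)) => [|| guv]; [nia | nia | rewrite (ginj _ _ guv) ltnn].
have hinj : injective h.
  by move=> u v huv; apply/ginj/eqP; case: ltngtP => //; rewrite -hg huv ltnn.
exists n, (n * M)%N, (block_point R f g M e); split.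
- by rewrite /M; nia.
- by rewrite /M !expnS; nia.
- split=> [u v uv|i].
    apply: finj; apply/eqP; rewrite -(eqr_nat R); apply/eqP.
    by move/rowP: uv => /(_ 0); rewrite !mxE.
  case: i => [[|[|//]] i2]; rewrite (tnth_nth C1) /=.
    by apply: (strip_order_plane (j := 0) finj _ fC1 gp) => v; rewrite mxE.
  apply: (strip_order_plane (j := 1) hinj _ (strip_order_mono hg gC2) gp) => v.
  by rewrite mxE.
(* Coordinates start at 0 and the grid at 1, hence the shift by -1. *)
- exists (-1), (-1) => v; exists (f v).+1, (h v).+1; split.
  + by rewrite -Vn; exact: flt.
  + have := elt v; have := glt v; rewrite Vn /h; set m := M => gv ev.
    by apply/andP; split=> //; nia.
  + by rewrite mxE /= mulrN1z -natr1 addrK.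
  + by rewrite mxE /= mulrN1z -natr1 addrK.
Qed.
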